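(* For a fixed $\nu\in\mathbb{N}$, suppose that $\delta,\delta^\nu\in(\epsilon,\infty]$, $\tau^\nu\in[0,\infty)$, $(F^\nu,G^\nu)$ is a $\tau^\nu$-minimizer of the training problem $(\mathrm{TP})^\nu$ (without risk constraints), and the following hold: (a) The risk measure $\mathcal{R}_0$ is real-valued, monotone, and convex. (b) $h^\nu(F,G)=0$ when $F$ and $G$ are constant mappings. (c) There are $\sigma^\nu,\kappa_0\in[0,\infty)$ such that for all $(x,y)\in C$ one has $|\psi_0(\xi,x,y)-\psi_0(\xi',x,y)|\le\kappa_0\|\xi-\xi'\|_2$ for all $\xi,\xi'\in\Xi$, and $|\psi_0^\nu(\xi,x,y)-\psi_0(\xi,x,y)|\le\sigma^\nu$ for all $\xi\in\Xi$. (d) $F+a\in\mathcal{F}$ for any $F\in\mathcal{F}$ and $a\in\mathbb{R}^n$; $G+b\in\mathcal{G}$ for any $G\in\mathcal{G}$ and $b\in\mathbb{R}^m$; and both $\mathcal{F}$ and $\mathcal{G}$ contain their respective zero functions. Then, the following three assertions are true: (i) The decision $(x^\nu,y^\nu)=\big(F^\nu(\boldsymbol{\xi}^\nu(\omega^\nu)),\mathbb{H}(G^\nu(\boldsymbol{\xi}^\nu(\omega^\nu)))\big)$, where $$\omega^\nu\in\operatorname*{argmin}_{\omega\in\Omega}\psi_0^\nu\big(\boldsymbol{\xi}^\nu(\omega),F^\nu(\boldsymbol{\xi}^\nu(\omega)),\mathbb{H}(G^\nu(\boldsymbol{\xi}^\nu(\omega)))\big),$$ satisfies $$(x^\nu,y^\nu)\in(2\sigma^\nu+\tau^\nu+2\kappa_0\operatorname{diam}\Xi)\text{-}\operatorname*{argmin}_{(x,y)\in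 C}\psi_0(\xi,x,y)\qquad\forall\xi\in\Xi.$$ (ii) The decision rule $(\bar F,\bar G)$ given, for $\xi\in\Xi$, by $\bar F(\xi)=F^\nu(\boldsymbol{\xi}^\nu(\bar\omega(\xi)))$ and $\bar G(\xi)=G^\nu(\boldsymbol{\xi}^\nu(\bar\omega(\xi)))$, where $$\bar\omega(\xi)\in\operatorname*{argmin}_{\omega\in\Omega}\psi_0\big(\xi,F^\nu(\boldsymbol{\xi}^\nu(\omega)),\mathbb{H}(G^\nu(\boldsymbol{\xi}^\nu(\omega)))\big),$$ satisfies $$\big(\bar F(\xi),\mathbb{H}(\bar G(\xi))\big)\in(2\sigma^\nu+\tau^\nu+2\kappa_0\operatorname{diam}\Xi)\text{-}\operatorname*{argmin}_{(x,y)\in C}\psi_0(\xi,x,y)\qquad\forall\xi\in\Xi.$$ (iii) Let $\lambda,\kappa_0'\in[0,\infty)$ be such that $$\|F^\nu(\xi'')-F^\nu(\xi')\|_2\le\lambda\|\xi''-\xi'\|_2\quad\forall\xi'',\xi'\in\Xi,$$ $$|\psi_0(\xi'',x'',y)-\psi_0(\xi',x',y)|\le\kappa_0'\sqrt{\|\xi''-\xi'\|_2^2+\|x''-x'\|_2^2}\quad\forall\xi'',\xi'\in\Xi,\ (x'',y)\in C,\ (x',y)\in C.$$ Then $$\big(F^\nu(\xi),\mathbb{H}(G^\nu(\xi))\big)\in\Big(2\sigma^\nu+\tau^\nu+\big(\kappa_0+\kappa_0'\sqrt{1+\lambda^2}\big)\operatorname{diam}\Xi\Big)\text{-}\operatorname*{argmin}_{(x,y)\in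 C}\psi_0(\xi,x,y)$$ for those $\xi\in\Xi$ producing $(F^\nu(\xi),\mathbb{H}(G^\nu(\xi)))\in C$ and $\mathbb{H}(G^\nu(\xi))=\mathbb{H}(G^\nu(\boldsymbol{\xi}^\nu(\omega)))$ for all $\omega\in\Omega$.
   Context: $C\subset\mathbb{R}^n\times\{0,1\}^m$ is nonempty and closed; $\psi_0,\psi_0^\nu:\mathbb{R}^r\times\mathbb{R}^n\times\mathbb{R}^m\to\mathbb{R}$ are continuous. For $\xi\in\mathbb{R}^r$ the actual problem is to minimize $\psi_0(\xi,x,y)$ over $(x,y)\in C$. For $\tau\in[0,\infty)$, $$\tau\text{-}\operatorname*{argmin}_{(x,y)\in C}\psi_0(\xi,x,y)=\Big\{(x,y)\in C\ \Big|\ \psi_0(\xi,x,y)\le\inf_{(x',y')\in C}\psi_0(\xi,x',y')+\tau<\infty\Big\}.$$ Heaviside mapping: $\mathbb{H}(v)=(w_1,\dots,w_s)$ for $v\in\mathbb{R}^s$, where $w_i=0$ if $v_i\le 0$ and $w_i=1$ otherwise. $(\Omega,2^\Omega,P)$ is a finite probability space with $P(\omega)>0$ for all $\omega\in\Omega$. Random variables are functions $\Omega\to\mathbb{R}$. A risk measure $\mathcal{R}$ assigns to each random variable $\boldsymbol{\eta}$ a number $\mathcal{R}(\boldsymbol{\eta})\in[-\infty,\infty]$, with $\mathcal{R}(\boldsymbol{\eta})=\eta$ whenever $\boldsymbol{\eta}$ equals the constant $\eta$ with probability one. It is monotone if $\mathcal{R}(\boldsymbol{\eta})\le\mathcal{R}(\boldsymbol{\eta}')$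 whenever $\boldsymbol{\eta}(\omega)\le\boldsymbol{\eta}'(\omega)$ for all $\omega$; it is convex if $\mathcal{R}((1-\lambda)\boldsymbol{\eta}+\lambda\boldsymbol{\eta}')\le(1-\lambda)\mathcal{R}(\boldsymbol{\eta})+\lambda\mathcal{R}(\boldsymbol{\eta}')$ for all $\lambda\in[0,1]$ and random variables $\boldsymbol{\eta},\boldsymbol{\eta}'$. $\mathcal{R}_0$ is a risk measure. $\boldsymbol{\xi}^\nu:\Omega\to\mathbb{R}^r$ is a random vector (its values are the training points). $\Xi\subset\mathbb{R}^r$ is a compact set containing $\boldsymbol{\xi}^\nu(\omega)$ for all $\omega\in\Omega$, and $\operatorname{diam}\Xi=\max_{\xi,\xi'\in\Xi}\|\xi-\xi'\|_2$. $\mathcal{F}$ is a set of continuous mappings $\Xi\to\mathbb{R}^n$ and $\mathcal{G}$ a set of continuous mappings $\Xi\to\mathbb{R}^m$. $h^\nu:\mathcal{F}\times\mathcal{G}\to[0,\infty)$. $F+a$ denotes $\xi\mapsto F(\xi)+a$. The number $\epsilon\in(0,\infty)$ is fixed; for $\delta\in(\epsilon,\infty]$, $D_\epsilon(\delta)=\big([-\delta,-\epsilon]\cup[\epsilon,\delta]\big)^m$ as a subset of $\mathbb{R}^m$. Training problem $(\mathrm{TP})^\nu$ without risk constraints: minimize over $F\in\mathcal{F}$, $G\in\mathcal{G}$ the quantity $$\mathcal{R}_0\Big(\psi_0^\nu\big(\boldsymbol{\xi}^\nu,F(\boldsymbol{\xi}^\nu),\mathbb{H}(G(\boldsymbol{\xi}^\nu))\big)\Big)+h^\nu(F,G)$$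 subject to $\big(F(\boldsymbol{\xi}^\nu(\omega)),\mathbb{H}(G(\boldsymbol{\xi}^\nu(\omega)))\big)\in C$ and $G(\boldsymbol{\xi}^\nu(\omega))\in D_\epsilon(\delta^\nu)$ for all $\omega\in\Omega$. The argument of $\mathcal{R}_0$ is the random variable $\omega\mapsto\psi_0^\nu(\boldsymbol{\xi}^\nu(\omega),F(\boldsymbol{\xi}^\nu(\omega)),\mathbb{H}(G(\boldsymbol{\xi}^\nu(\omega))))$. A $\tau^\nu$-minimizer is a feasible $(F^\nu,G^\nu)$ whose objective value is at most $\mathfrak{m}^\nu+\tau^\nu<\infty$, where $\mathfrak{m}^\nu$ is the infimum of the objective over the feasible set. *)

(* Defs.v *)
From HB Require Import structures.
From mathcomp Require Import all_boot all_order all_algebra.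
From mathcomp Require Import all_classical all_reals all_analysis.
Set Implicit Arguments.
Unset Strict Implicit.
Unset Printing Implicit Defensive.
Import Order.TTheory GRing.Theory Num.Theory.
Import numFieldTopology.Exports numFieldNormedType.Exports.
Local Open Scope classical_set_scope.
Local Open Scope ring_scope.

(* The library norm `|x| on 'rV[R]_n is the sup norm, hence this definition;
   both norms induce the topology that the library puts on 'rV[R]_n. *)
Definition norm2 (R : realType) (n : nat) (x : 'rV[R]_n) : R :=
  Num.sqrt (\sum_(i < n) x 0 i ^+ 2).

(* For a nonempty compact A this supremum is a maximum, see [diam_max]. *)
Definition diam (R : realType) (n : nat) (A : set 'rV[R]_n) : R :=
  sup [set norm2 (x - y) | x in A & y in A].

Definition Heaviside (R : realType) (s : nat) (v : 'rV[R]_s) : 'rV[R]_s :=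
  \row_i (if v 0 i <= 0 then 0 else 1).

(* The bound delta may be +oo, in which case [-delta, -eps] and [eps, delta]
   are read as ]-oo, -eps] and [eps, +oo[ since the coordinates are real. *)
Definition Dset (R : realType) (m : nat) (eps : R) (delta : \bar R) :
    set 'rV[R]_m :=
  [set v | forall i : 'I_m,
     ((- delta <= (v 0 i)%:E)%E /\ v 0 i <= - eps) \/
     (eps <= v 0 i /\ ((v 0 i)%:E <= delta)%E)].

(* When the infimum is -oo (or +oo) this set is empty for real-valued f. *)
Definition near_argmin (R : realType) (T : Type) (S : set T) (f : T -> \bar R)
    (tau : R) : set T :=
  [set x | [/\ S x,
     (f x <= ereal_inf [set f x' | x' in S] + tau%:E)%E &
     (ereal_inf [set f x' | x' in S] + tau%:E < +oo)%E]].

Definition argmin (R : realType) (T : Type) (f : T -> R) : set T :=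
  [set t | forall t', f t <= f t'].

Definition continuous3 (R : realType) (r n m : nat)
    (psi : 'rV[R]_r -> 'rV[R]_n -> 'rV[R]_m -> R) : Prop :=
  continuous (fun p : 'rV[R]_r * 'rV[R]_n * 'rV[R]_m => psi p.1.1 p.1.2 p.2).

(* (Omega, 2^Omega, P) is a finite probability space without null atoms. *)
Definition finite_prob_space (R : realType) (d : measure_display)
    (Omega : measurableType d) (P : probability Omega R) : Prop :=
  [/\ finite_set [set: Omega],
      forall A : set Omega, measurable A &
      forall w : Omega, (0 < P [set w])%E].

Definition risk_measure (R : realType) (d : measure_display)
    (Omega : measurableType d) (P : probability Omega R)
    (Rm : (Omega -> R) -> \bar R) : Prop :=
  forall (eta : Omega -> R) (c : R),
    P [set w | eta w = c] = 1%E -> Rm eta = c%:E.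

Definition real_valued_risk (R : realType) (Omega : Type)
    (Rm : (Omega -> R) -> \bar R) : Prop :=
  forall eta : Omega -> R, Rm eta \is a fin_num.

Definition monotone_risk (R : realType) (Omega : Type)
    (Rm : (Omega -> R) -> \bar R) : Prop :=
  forall eta eta' : Omega -> R,
    (forall w, eta w <= eta' w) -> (Rm eta <= Rm eta')%E.

(* The sum follows the library's convention +oo + -oo = -oo, which plays no
   role for a real-valued Rm. *)
Definition convex_risk (R : realType) (Omega : Type)
    (Rm : (Omega -> R) -> \bar R) : Prop :=
  forall (l : R) (eta eta' : Omega -> R), 0 <= l <= 1 ->
    (Rm (fun w => (1 - l) * eta w + l * eta' w)%R
       <= (1 - l)%R%:E * Rm eta + l%:E * Rm eta')%E.

Definition constant_map (A B : Type) (F : A -> B) : Prop :=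
  exists b : B, forall a : A, F a = b.

(* Mappings on Xi have the subtype of points of Xi as their domain; the library
   equips it with the subspace topology. *)
Section TrainingProblem.
Context (R : realType) (Omega : Type) (r n m : nat).
Context (C : set ('rV[R]_n * 'rV[R]_m)) (Xi : set 'rV[R]_r).
Context (xinu : Omega -> Xi).
Context (FF : set (Xi -> 'rV[R]_n)) (GG : set (Xi -> 'rV[R]_m)).
Context (psi : 'rV[R]_r -> 'rV[R]_n -> 'rV[R]_m -> R).
Context (R0 : (Omega -> R) -> \bar R).
Context (h : (Xi -> 'rV[R]_n) -> (Xi -> 'rV[R]_m) -> R).
Context (eps : R) (delta : \bar R) (tau : R).

Definition TP_feasible : set ((Xi -> 'rV[R]_n) * (Xi -> 'rV[R]_m)) :=
  [set FG | [/\ FF FG.1, GG FG.2,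
     forall w, C (FG.1 (xinu w), Heaviside (FG.2 (xinu w))) &
     forall w, Dset eps delta (FG.2 (xinu w))]].

Definition TP_objective (FG : (Xi -> 'rV[R]_n) * (Xi -> 'rV[R]_m)) : \bar R :=
  (R0 (fun w => psi (val (xinu w)) (FG.1 (xinu w)) (Heaviside (FG.2 (xinu w))))
     + (h FG.1 FG.2)%:E)%E.

Definition TP_minimizer : set ((Xi -> 'rV[R]_n) * (Xi -> 'rV[R]_m)) :=
  near_argmin TP_feasible TP_objective tau.

End TrainingProblem.

Lemma norm2B_continuous (R : realType) (n : nat) :
  continuous (fun p : 'rV[R]_n * 'rV[R]_n => norm2 (p.1 - p.2)).
Proof.
move=> p; rewrite /norm2.
apply: (@continuous_comp _ _ _
  (fun p : 'rV[R]_n * 'rV[R]_n => \sum_(i < n) (p.1 - p.2) 0 i ^+ 2)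
  Num.sqrt); last exact: sqrt_continuous.
apply: cvg_big => [|i _]; first exact: add_continuous.
have cB : {for p, continuous
    (fun p : 'rV[R]_n * 'rV[R]_n => p.1 0 i - p.2 0 i)}.
  apply: cvgB.
    apply: (@continuous_comp _ _ _ fst (fun M : 'rV[R]_n => M 0 i)).
      exact: cvg_fst.
    exact: coord_continuous.
  apply: (@continuous_comp _ _ _ snd (fun M : 'rV[R]_n => M 0 i)).
    exact: cvg_snd.
  exact: coord_continuous.
under eq_cvg => q do rewrite !mxE.
by rewrite !mxE; apply: (cvgM cB cB).
Qed.

Lemma diam_max (R : realType) (n : nat) (A : set 'rV[R]_n) :
  A !=set0 -> compact A ->
  (exists x y, [/\ A x, A y & diam A = norm2 (x - y)]) /\
  (forall x y, A x -> A y -> norm2 (x - y) <= diam A).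
Proof.
move=> [a Aa] cA.
have [] := @compact_EVT_max _ R
    (fun p : 'rV[R]_n * 'rV[R]_n => norm2 (p.1 - p.2)) (A `*` A).
- by exists (a, a).
- exact: compact_setX.
- exact/continuous_subspaceT/norm2B_continuous.
move=> [x y] /set_mem[/= Ax Ay] xyM.
have ub u v : A u -> A v -> norm2 (u - v) <= norm2 (x - y).
  by move=> Au Av; apply: (xyM (u, v)); apply: mem_set.
have dE : diam A = norm2 (x - y).
  apply/eqP; rewrite eq_le; apply/andP; split.
    apply: ge_sup; first by exists (norm2 (x - y)), x => //; exists y.
    by move=> _ [u Au [v Av <-]]; apply: ub.
  apply: ub_le_sup; last by exists x => //; exists y.
  by exists (norm2 (x - y)) => _ [u Au [v Av <-]]; apply: ub.
by split; [exists x, y | rewrite dE].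
Qed.

(* Main.v *)
(* For every (x, y) in C the constant rules F = x and G = +-eps, signed according
   to y, are feasible and cost at most psi0 xi x y + sigma + kappa0 diam Xi by
   monotonicity of the risk measure. Hence any lower bound on the training losses
   of the near-minimizer is also a lower bound on
   psi0 xi x y + sigma + kappa0 diam Xi + tau. Each assertion applies this to a
   lower bound given by psi0 xi at the proposed decision, up to a tolerance. *)

Require Import Defs.
From HB Require Import structures.
From mathcomp Require Import all_boot all_order all_algebra.
From mathcomp Require Import all_classical all_reals all_analysis.
From mathcomp Require Import lra.
Set Implicit Arguments.
Unset Strict Implicit.
Unset Printing Implicit Defensive.
Import Order.TTheory GRing.Theory Num.Theory.
Import numFieldTopology.Exports numFieldNormedType.Exports.
Local Open Scope classical_set_scope.
Local Open Scope ring_scope.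

(** The pointwise bound makes [f t - tau] a lower bound of the values on [S], hence of their
    infimum. The infimum is below [+oo] because [t] itself lies in [S]. *)
Lemma near_argmin_EFin (R : realType) (T : Type) (S : set T) (f : T -> R)
    (tau : R) (t : T) :
  S t -> (forall t', S t' -> f t <= f t' + tau) ->
  near_argmin S (fun t => (f t)%:E) tau t.
Proof.
move=> St tmin; split=> //.
  rewrite -leeBlDr// -EFinB; apply: le_ereal_inf_tmp => _ [t' St' <-].
  by rewrite lee_fin lerBlDr tmin.
rewrite lte_add_pinfty ?ltry//.
by apply: le_lt_trans (ltry (f t)); apply: ereal_inf_lbound; exists t.
Qed.

(** Supplies a constant value for [G] that realizes a prescribed binary [y] and has every coordinate
    of modulus [eps]. *)
Lemma Heaviside_sign (R : realType) (m : nat) (eps : R) (y : 'rV[R]_m) :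
  0 < eps -> (forall i, y 0 i = 0 \/ y 0 i = 1) ->
  Heaviside (\row_i (if y 0 i == 0 then - eps else eps)) = y.
Proof.
move=> eps0 y01; apply/rowP => i; rewrite !mxE.
have [->|->] := y01 i; first by rewrite eqxx oppr_le0 (ltW eps0).
by rewrite oner_eq0 leNgt eps0.
Qed.

Lemma Dset_sign (R : realType) (m : nat) (eps : R) (delta : \bar R)
    (y : 'rV[R]_m) :
  (eps%:E <= delta)%E ->
  Dset eps delta (\row_i (if y 0 i == 0 then - eps else eps)).
Proof.
move=> ed i; rewrite !mxE; case: ifPn => _; last by right.
by left; rewrite EFinN leeN2.
Qed.

Section RiskConstants.
Context (R : realType) (d : measure_display) (Omega : measurableType d).
Context (P : probability Omega R) (Rm : (Omega -> R) -> \bar R).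
Hypotheses (Rm_risk : risk_measure P Rm) (Rm_monotone : monotone_risk Rm).

Let risk_cst (c : R) : Rm (fun=> c) = c%:E.
Proof.
apply: Rm_risk; rewrite -[RHS](probability_setT P); congr (P _).
by apply/seteqP; split.
Qed.

(** Monotonicity is applied against the constant random variable [c], whose risk is [c]. *)
Lemma risk_ge (eta : Omega -> R) (c : R) :
  (forall w, c <= eta w) -> (c%:E <= Rm eta)%E.
Proof. by move=> ?; rewrite -risk_cst; apply: Rm_monotone. Qed.

Lemma risk_le (eta : Omega -> R) (c : R) :
  (forall w, eta w <= c) -> (Rm eta <= c%:E)%E.
Proof. by move=> ?; rewrite -risk_cst; apply: Rm_monotone. Qed.

End RiskConstants.

Theorem theorem4p2
  (R : realType) (r n m : nat)
  (* the actual problem *)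
  (C : set ('rV[R]_n * 'rV[R]_m))
  (C_binary : forall x y, C (x, y) -> forall i, y 0 i = 0 \/ y 0 i = 1)
  (C_nonempty : C !=set0) (C_closed : closed C)
  (psi0 psi0nu : 'rV[R]_r -> 'rV[R]_n -> 'rV[R]_m -> R)
  (psi0_cont : continuous3 psi0) (psi0nu_cont : continuous3 psi0nu)
  (* the finite probability space and the risk measure *)
  (d : measure_display) (Omega : measurableType d) (P : probability Omega R)
  (P_finite : finite_prob_space P)
  (R0 : (Omega -> R) -> \bar R) (R0_risk : risk_measure P R0)
  (* the training data and the admissible decision rules *)
  (Xi : set 'rV[R]_r) (Xi_compact : compact Xi)
  (xinu : Omega -> Xi)
  (FF : set (Xi -> 'rV[R]_n)) (FF_cont : forall F, FF F -> continuous F)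
  (GG : set (Xi -> 'rV[R]_m)) (GG_cont : forall G, GG G -> continuous G)
  (hnu : (Xi -> 'rV[R]_n) -> (Xi -> 'rV[R]_m) -> R)
  (hnu_ge0 : forall F G, FF F -> GG G -> 0 <= hnu F G)
  (eps : R) (eps_gt0 : 0 < eps)
  (* a near-minimizer of the training problem *)
  (delta deltanu : \bar R)
  (delta_gt : (eps%:E < delta)%E) (deltanu_gt : (eps%:E < deltanu)%E)
  (taunu : R) (taunu_ge0 : 0 <= taunu)
  (Fnu : Xi -> 'rV[R]_n) (Gnu : Xi -> 'rV[R]_m)
  (FGnu_min :
    TP_minimizer C xinu FF GG psi0nu R0 hnu eps deltanu taunu (Fnu, Gnu))
  (* (a) *)
  (R0_real : real_valued_risk R0) (R0_monotone : monotone_risk R0)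
  (R0_convex : convex_risk R0)
  (* (b) *)
  (hnu_const : forall F G, FF F -> GG G ->
     constant_map F -> constant_map G -> hnu F G = 0)
  (* (c) *)
  (sigmanu kappa0 : R) (sigmanu_ge0 : 0 <= sigmanu) (kappa0_ge0 : 0 <= kappa0)
  (psi0_lip : forall x y, C (x, y) -> forall xi xi' : Xi,
     `|psi0 (val xi) x y - psi0 (val xi') x y|
       <= kappa0 * norm2 (val xi - val xi'))
  (psi0nu_close : forall x y, C (x, y) -> forall xi : Xi,
     `|psi0nu (val xi) x y - psi0 (val xi) x y| <= sigmanu)
  (* (d) *)
  (FF_shift : forall F (a : 'rV[R]_n), FF F -> FF (fun xi => F xi + a))
  (GG_shift : forall G (b : 'rV[R]_m), GG G -> GG (fun xi => G xi + b))
  (FF_0 : FF (fun=> 0)) (GG_0 : GG (fun=> 0)) :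
  (* (i) *)
  (forall omeganu : Omega,
     argmin (fun w => psi0nu (val (xinu w)) (Fnu (xinu w))
                             (Heaviside (Gnu (xinu w)))) omeganu ->
     forall xi : Xi,
       near_argmin C (fun p => (psi0 (val xi) p.1 p.2)%:E)
         (2 * sigmanu + taunu + 2 * kappa0 * diam Xi)
         (Fnu (xinu omeganu), Heaviside (Gnu (xinu omeganu))))
  /\
  (* (ii) *)
  (forall omegabar : Xi -> Omega,
     (forall xi : Xi,
        argmin (fun w => psi0 (val xi) (Fnu (xinu w))
                              (Heaviside (Gnu (xinu w)))) (omegabar xi)) ->
     let Fbar := fun xi : Xi => Fnu (xinu (omegabar xi)) in
     let Gbar := fun xi : Xi => Gnu (xinu (omegabar xi)) in
     forall xi : Xi,
       near_argmin C (fun p => (psi0 (val xi) p.1 p.2)%:E)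
         (2 * sigmanu + taunu + 2 * kappa0 * diam Xi)
         (Fbar xi, Heaviside (Gbar xi)))
  /\
  (* (iii) *)
  (forall lambda kappa0' : R, 0 <= lambda -> 0 <= kappa0' ->
     (forall xi'' xi' : Xi,
        norm2 (Fnu xi'' - Fnu xi') <= lambda * norm2 (val xi'' - val xi')) ->
     (forall (xi'' xi' : Xi) x'' x' y, C (x'', y) -> C (x', y) ->
        `|psi0 (val xi'') x'' y - psi0 (val xi') x' y|
          <= kappa0' * Num.sqrt (norm2 (val xi'' - val xi') ^+ 2
                                 + norm2 (x'' - x') ^+ 2)) ->
     forall xi : Xi,
       C (Fnu xi, Heaviside (Gnu xi)) ->
       (forall w : Omega, Heaviside (Gnu xi) = Heaviside (Gnu (xinu w))) ->
       near_argmin C (fun p => (psi0 (val xi) p.1 p.2)%:E)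
         (2 * sigmanu + taunu
            + (kappa0 + kappa0' * Num.sqrt (1 + lambda ^+ 2)) * diam Xi)
         (Fnu xi, Heaviside (Gnu xi))).
Proof.
have [[/= FFnu GGnu Cnu _] obj_le _] := FGnu_min.
have dist_diam (xi xi' : Xi) : norm2 (val xi - val xi') <= diam Xi.
  have Xi0 : Xi !=set0 by exists (val xi); exact: set_valP.
  by have [_] := diam_max Xi0 Xi_compact; apply; exact: set_valP.
have psi0_diam x y (xi xi' : Xi) : C (x, y) ->
    psi0 (val xi) x y <= psi0 (val xi') x y + kappa0 * diam Xi.
  move=> Cxy; rewrite -lerBlDl (le_trans (ler_norm _))//.
  rewrite (le_trans (psi0_lip _ _ Cxy xi xi'))//.
  by rewrite ler_wpM2l// dist_diam.
have close_le x y (xi : Xi) : C (x, y) ->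
    psi0nu (val xi) x y <= psi0 (val xi) x y + sigmanu /\
    psi0 (val xi) x y <= psi0nu (val xi) x y + sigmanu.
  by move=> Cxy; have := psi0nu_close _ _ Cxy xi; rewrite ler_norml; lra.
have loss_bound (c : R) (xi : Xi) x y : C (x, y) ->
    (forall w, c <= psi0nu (val (xinu w)) (Fnu (xinu w))
                           (Heaviside (Gnu (xinu w)))) ->
    c <= psi0 (val xi) x y + sigmanu + kappa0 * diam Xi + taunu.
  move=> Cxy c_le.
  set b : 'rV[R]_m := \row_i (if y 0 i == 0 then - eps else eps).
  have Hb : Heaviside b = y by apply: Heaviside_sign => //; exact: C_binary Cxy.
  (* The sum with [0] is kept so that [F] and [G] are literally shifts of the zero functions, as in
     (d). *)
  pose F : Xi -> 'rV[R]_n := fun=> 0 + x.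
  pose G : Xi -> 'rV[R]_m := fun=> 0 + b.
  have FFF : FF F by apply: (FF_shift (fun=> 0)).
  have GGG : GG G by apply: (GG_shift (fun=> 0)).
  have feas : TP_feasible C xinu FF GG eps deltanu (F, G).
    split=> //= w; rewrite /F /G !add0r ?Hb//.
    exact/Dset_sign/ltW.
  have obj_cst : (TP_objective xinu psi0nu R0 hnu (F, G) <=
      (psi0 (val xi) x y + sigmanu + kappa0 * diam Xi)%:E)%E.
    (* The regularizer vanishes by (b). Each loss is within [sigmanu] of [psi0] at the training
       point, which exceeds [psi0] at [xi] by at most [kappa0 * diam Xi]. *)
    rewrite /TP_objective /= hnu_const//; [|by exists (0 + x)|by exists (0 + b)].
    rewrite adde0; apply: (risk_le R0_risk R0_monotone) => w.
    rewrite /F /G !add0r Hb.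
    have [+ _] := close_le _ _ (xinu w) Cxy.
    have := psi0_diam _ _ (xinu w) xi Cxy; lra.
  have inf_le : (ereal_inf [set TP_objective xinu psi0nu R0 hnu FG |
      FG in TP_feasible C xinu FF GG eps deltanu] <=
      (psi0 (val xi) x y + sigmanu + kappa0 * diam Xi)%:E)%E.
    by apply: le_trans obj_cst; apply: ereal_inf_lbound; exists (F, G).
  rewrite -lee_fin EFinD; apply: le_trans (leeD2r taunu%:E inf_le).
  (* The objective at [(Fnu, Gnu)] is at least [c]: the risk of losses bounded below by [c] is at
     least [c], and [hnu] is nonnegative. *)
  apply: le_trans obj_le; rewrite -[c%:E]adde0; apply: leeD.
    exact: (risk_ge R0_risk R0_monotone).
  by rewrite lee_fin hnu_ge0.
split; [|split].
- move=> w0 w0_min xi; apply: near_argmin_EFin => [|[x y] Cxy /=].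
    exact: Cnu.
  (* Here [c] is the smallest training loss. Returning from it to [psi0] at [xi] costs a second
     [sigmanu + kappa0 * diam Xi]. *)
  have := loss_bound _ xi _ _ Cxy w0_min.
  have := psi0_diam _ _ xi (xinu w0) (Cnu w0).
  have [_] := close_le _ _ (xinu w0) (Cnu w0); lra.
- move=> wbar wbar_min /= xi; apply: near_argmin_EFin => [|[x y] Cxy /=].
    exact: Cnu.
  set v := psi0 (val xi) _ _.
  (* At [xi], [v] is minimal among the training decisions. Each decision is then moved from [xi] to
     its own training point, and [psi0] is replaced by [psi0nu]. *)
  have {}/loss_bound : forall w, v - sigmanu - kappa0 * diam Xi <=
      psi0nu (val (xinu w)) (Fnu (xinu w)) (Heaviside (Gnu (xinu w))).
    move=> w; have := wbar_min xi w; rewrite -/v.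
    have := psi0_diam _ _ xi (xinu w) (Cnu w).
    have [_] := close_le _ _ (xinu w) (Cnu w); lra.
  by move=> /(_ xi _ _ Cxy); lra.
move=> lambda kappa0' lambda0 kappa0'0 F_lip psi0_lip' xi Cxi Gxi.
apply: near_argmin_EFin => [//|[x y] Cxy /=].
set v := psi0 (val xi) _ _; set s := Num.sqrt (1 + lambda ^+ 2).
(* The point and the decision now move together, at a cost governed by [kappa0']; the single
   [kappa0] term of the tolerance comes from [loss_bound]. *)
have {}/loss_bound : forall w, v - sigmanu - kappa0' * (s * diam Xi) <=
    psi0nu (val (xinu w)) (Fnu (xinu w)) (Heaviside (Gnu (xinu w))).
  move=> w; have [_] := close_le _ _ (xinu w) (Cnu w).
  (* The joint Lipschitz bound compares only decisions with the same [y], so the two binary parts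
     are identified first. *)
  have Cw := Cnu w; rewrite -Gxi in Cw *.
  have := le_trans (ler_norm _) (psi0_lip' xi (xinu w) _ _ _ Cxi Cw).
  rewrite -/v.
  set q := Num.sqrt (norm2 _ ^+ 2 + _).
  (* Under the root, the first square is at most [diam Xi ^+ 2] and the second at most
     [(lambda * diam Xi) ^+ 2]; since [diam Xi] is nonnegative, it factors out of the root. *)
  have /(ler_wpM2l kappa0'0) : q <= s * diam Xi.
    have N0 (k : nat) (z : 'rV[R]_k) : 0 <= norm2 z by exact: sqrtr_ge0.
    have dist0 := N0 _ (val xi - val (xinu w)).
    have diam0 := le_trans dist0 (dist_diam xi (xinu w)).
    rewrite -[diam Xi]ger0_norm// -sqrtr_sqr -sqrtrM; last first.
      by rewrite addr_ge0 ?sqr_ge0.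
    apply: ler_wsqrtr; rewrite mulrDl mul1r -exprMn.
    apply: lerD; apply: lerXn2r; rewrite ?nnegrE ?mulr_ge0//.
      exact: dist_diam.
    by apply: le_trans (F_lip _ _) _; rewrite ler_wpM2l//; exact: dist_diam.
  lra.
move=> /(_ xi _ _ Cxy); rewrite mulrDl mulrA; lra.
Qed.
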